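(* Let $T=(V(T),E(T);f,g)$ be a weighted tree with two or more vertices, and let $v_i$ and $v_j$ be two distinct vertices of $T$. Consider the following procedure. Step 1 (initialize): set $p(v_s)=f(v_s)$ for all $v_s\in V(T)$. Step 2: if $T$ is a path, and $v_i$ and $v_j$ are its two pendant vertices, go to Step 5; otherwise, go to Step 3. Step 3 (contract): (a) choose a pendant vertex $u$ of the current tree which is different from $v_i$ and $v_j$, and let $e=(u,v)$ denote the pendant edge; (b) replace $p(v)$ with $p(v)(p(u)g(e)+1)$; (c) eliminate the vertex $u$ and the edge $e$. Step 4: if there exists no vertex $u$ satisfying the condition (a) in Step 3, go to Step 5; otherwise, go to Step 3. Step 5: answer $\prod_{v\in V(P_{v_iv_j})}p(v)\prod_{e\in E(P_{v_iv_j})}g(e)$, where $P_{v_iv_j}$ denotes the unique path of $T$ from $v_i$ to $v_j$. Then the answer of the procedure is the generating function of subtrees of $T$ containing $v_i$ and $v_j$, i.e. $F(T;f,g;v_i,v_j)=\prod_{v\in V(P_{v_iv_j})}p(v)\prod_{e\in E(P_{v_iv_j})}g(e)$.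
   Context: Let $\mathcal R$ be a commutative ring with unit element $1$. A weighted tree $T=(V(T),E(T);f,g)$ is a finite tree with a vertex-weight function $f:V(T)\to\mathcal R$ and an edge-weight function $g:E(T)\to\mathcal R$. A subtree of $T$ is a nonempty connected subgraph of $T$ (single vertices are allowed). The weight $\omega(T_1)$ of a subtree $T_1$ is the product of the weights of all vertices and edges of $T_1$. For vertices $v_i,v_j$, $F(T;f,g;v_i,v_j)=\sum_{T_1}\omega(T_1)$, summed over all subtrees $T_1$ of $T$ containing both $v_i$ and $v_j$. A pendant vertex is a vertex of degree $1$; the edge incident to it is its pendant edge. *)

(* Defs.v *)
From HB Require Import structures.
From mathcomp Require Import all_boot all_order all_algebra.
From Stdlib Require Export Relation_Operators.

Set Implicit Arguments.
Unset Strict Implicit.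
Unset Printing Implicit Defensive.

Import GRing.Theory.
Local Open Scope ring_scope.

Section Graphs.
Variable V : finType.

(* A finite graph whose vertices are taken in the ambient type V: a set of
   vertices paired with a set of edges, the edge (x, y) being [set x; y].
   Vertex sets are explicit so that subgraphs, and the trees left after
   deleting vertices, have the same type. *)
Definition graph : finType := ({set V} * {set {set V}})%type.
Definition verts (G : graph) : {set V} := G.1.
Definition edges (G : graph) : {set {set V}} := G.2.

Definition wf_graph (G : graph) : bool :=
  [forall e in edges G, (#|e| == 2)%N && (e \subset verts G)].

(* Irreflexive on a well-formed graph, since [set x; x] is a singleton. *)
Definition adj (G : graph) : rel V := fun x y => [set x; y] \in edges G.

Definition connected (G : graph) : bool :=
  [forall x in verts G, forall y in verts G, connect (adj G) x y].

Definition acyclic (G : graph) : Prop :=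
  forall c : seq V, (2 < size c)%N -> uniq c -> ~~ cycle (adj G) c.

Definition is_tree (G : graph) : Prop :=
  [/\ wf_graph G, verts G != set0, connected G & acyclic G].

Definition subgraph (H G : graph) : bool :=
  [&& wf_graph H, verts H \subset verts G & edges H \subset edges G].

Definition subtree (H G : graph) : bool :=
  [&& subgraph H G, verts H != set0 & connected H].

Definition degree (G : graph) (u : V) : nat :=
  #|[set e in edges G | u \in e]|.

Definition pendant (G : graph) (u : V) : bool :=
  (u \in verts G) && (degree G u == 1)%N.

(* Edges joining consecutive vertices of the sequence x :: s. *)
Definition path_edges (x : V) (s : seq V) : seq {set V} :=
  pairmap (fun a b => [set a; b]) x s.

(* x :: s lists the vertices of a path of G from x to y. *)
Definition path_from_to (G : graph) (x y : V) (s : seq V) : bool :=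
  [&& x \in verts G, path (adj G) x s, uniq (x :: s) & last x s == y].

Definition is_path (G : graph) : Prop :=
  exists (x : V) (s : seq V),
    [/\ uniq (x :: s), verts G = [set y in x :: s] &
        edges G = [set e in path_edges x s]].

End Graphs.

Section Weights.
Variables (V : finType) (R : comPzRingType).

(* f and g are total functions; only their values on the vertices and edges of
   the tree under consideration matter. *)
Definition weight (f : V -> R) (g : {set V} -> R) (H : graph V) : R :=
  (\prod_(v in verts H) f v) * \prod_(e in edges H) g e.

Definition subtree_gf (T : graph V) (f : V -> R) (g : {set V} -> R)
    (vi vj : V) : R :=
  \sum_(H : graph V | [&& subtree H T, vi \in verts H & vj \in verts H])
     weight f g H.

End Weights.

Section Procedure.
Variables (V : finType) (R : comPzRingType).
Variables (T : graph V) (f : V -> R) (g : {set V} -> R) (vi vj : V).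

(* Control states of the procedure. Step2, Step3, Step4 and Step5 carry the
   current tree and the current values of p. *)
Inductive state : Type :=
  | Step1
  | Step2 of graph V & (V -> R)
  | Step3 of graph V & (V -> R)
  | Step4 of graph V & (V -> R)
  | Step5 of graph V & (V -> R)
  | Answer of R.

Definition end_path (G : graph V) : Prop :=
  is_path G /\ [set u | pendant G u] = [set vi; vj].

Definition contractible (G : graph V) (u : V) : bool :=
  [&& pendant G u, u != vi & u != vj].

(* One transition of the procedure, nondeterministic in the choice of the
   pendant vertex u. *)
Inductive step : state -> state -> Prop :=
  | step_init : step Step1 (Step2 T f)
  | step_test_path G p : end_path G -> step (Step2 G p) (Step5 G p)
  | step_test_other G p : ~ end_path G -> step (Step2 G p) (Step3 G p)
  | step_contract G p u v :
      contractible G u -> [set u; v] \in edges G ->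
      step (Step3 G p)
           (Step4 (verts G :\ u, edges G :\ [set u; v])
                  [eta p with v |-> p v * (p u * g [set u; v] + 1)])
  | step_stop G p :
      ~ (exists u, contractible G u) -> step (Step4 G p) (Step5 G p)
  | step_again G p :
      (exists u, contractible G u) -> step (Step4 G p) (Step3 G p)
  | step_answer G p s :
      path_from_to T vi vj s ->
      step (Step5 G p)
           (Answer ((\prod_(v <- vi :: s) p v)
                    * \prod_(e <- path_edges vi s) g e)).

Definition reachable : state -> Prop := clos_refl_trans state step Step1.

(* No infinite execution starts from Step1. *)
Definition terminates : Prop := Acc (fun st' st => step st st') Step1.

(* An execution can only stop by giving an answer. *)
Definition never_stuck : Prop :=
  forall st, reachable st ->
    (exists a, st = Answer a) \/ (exists st', step st st').

End Procedure.

Arguments Step1 {V R}.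
Arguments Answer {V R}.

(* Main.v *)
(* Contracting a pendant vertex u with neighbour v preserves the generating
   function: a subtree H of the reduced tree extends to the original tree as H
   itself or, exactly when v is in H, also as H with u and the edge uv added,
   which multiplies its weight by p(u) g(uv). So each subtree through v picks up
   the factor p(u) g(uv) + 1, which is what the new value of p(v) contributes.
   When every pendant vertex is vi or vj, the tree is the path from vi to vj,
   whose only subtree containing both ends is the whole path. *)

Require Import Defs.
From HB Require Import structures.
From mathcomp Require Import all_boot all_order all_algebra.

Set Implicit Arguments.
Unset Strict Implicit.
Unset Printing Implicit Defensive.

Import GRing.Theory.
Local Open Scope ring_scope.

Section GraphTheory.
Variable V : finType.
Implicit Types (G H : graph V) (x y u v w : V) (s t : seq V).

(** * Adjacency, connecting paths and pendant vertices *)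

Lemma adj_sym G : symmetric (adj G).
Proof. by move=> x y; rewrite /adj setUC. Qed.

Lemma edgeP G u e : wf_graph G -> e \in edges G -> u \in e ->
  exists2 w, w != u & e = [set u; w].
Proof.
move=> /forall_inP wfG /wfG /andP[/cards2P[a [b [neq_ab ->]]] _].
rewrite !inE => /orP[] /eqP->; first by exists b; rewrite // eq_sym.
by exists a; rewrite // setUC.
Qed.

Lemma adj_verts G x y : wf_graph G -> adj G x y ->
  [/\ x \in verts G, y \in verts G & x != y].
Proof.
move=> /forall_inP wfG /wfG /andP[]; rewrite cards2 eqSS eqb1 => neq_xy.
by rewrite subUset !sub1set => /andP[-> ->].
Qed.

Lemma subgraph_wf H G : subgraph H G -> wf_graph H.
Proof. by case/and3P. Qed.

Lemma subgraph_adj H G : subgraph H G -> subrel (adj H) (adj G).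
Proof. by case/and3P=> _ _ /subsetP sHG x y /sHG. Qed.

Lemma connected_path G x y : connected G -> x \in verts G -> y \in verts G ->
  exists s, path_from_to G x y s.
Proof.
move=> /forall_inP cG xG yG; have /forall_inP/(_ y yG) := cG x xG.
case/connectP=> s0 Gs0 ->; case/shortenP: Gs0 => s Gs Us _.
by exists s; rewrite /path_from_to xG Gs Us eqxx.
Qed.

Lemma set2_injr u v w : u != v -> [set u; v] = [set u; w] -> v = w.
Proof.
move=> neq_uv eq_uvw; have: v \in [set u; w] by rewrite -eq_uvw set22.
by rewrite !inE eq_sym (negPf neq_uv) => /eqP.
Qed.

Lemma pendant_adj G u v w : wf_graph G -> pendant G u ->
  adj G u v -> adj G u w -> w = v.
Proof.
move=> wfG /andP[_ /cards1P[e Ee]] uv uw.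
have [_ _ neq_uw] := adj_verts wfG uw.
have: [set u; v] \in [set e] by rewrite -Ee inE set21 andbT.
have: [set u; w] \in [set e] by rewrite -Ee inE set21 andbT.
by move=> /set1P <- /set1P /esym /set2_injr; apply.
Qed.

Lemma nonpendant_adj G u v : wf_graph G -> ~~ pendant G u -> adj G u v ->
  exists2 w, w != v & adj G u w.
Proof.
move=> wfG + uv; have [uG _ neq_uv] := adj_verts wfG uv.
rewrite /pendant uG /= /degree; set E := finset _ => degu.
have uvE: [set u; v] \in E by rewrite inE set21 andbT.
have /card_gt0P[e]: (0 < #|E :\ [set u; v]|)%N.
  by move: degu; rewrite (cardsD1 [set u; v]) uvE add1n eqSS lt0n.
rewrite !inE => /and3P[neq_e eG ue].
have [w _ def_e] := edgeP wfG eG ue; exists w; last by rewrite /adj -def_e.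
by apply: contraNneq neq_e => <-; rewrite def_e.
Qed.

(** * Paths in acyclic graphs: uniqueness, edges and chords *)

(** Every edge of an acyclic graph is a bridge: a simple path from [a] back to [x] avoiding the edge
    [xa] would close up with it into a cycle. *)
Lemma acyclic_bridge G x a : acyclic G -> adj G x a -> x != a ->
  ~~ connect [rel b c | adj G b c && ([set b; c] != [set x; a])] a x.
Proof.
move=> acG xa neq_xa; apply/connectP=> -[s0 Gs0 def_x].
move: def_x; case/shortenP: Gs0 => s Gs Us _ def_x.
have Gs': path (adj G) a s by apply: sub_path Gs => b c /andP[].
suff /acG/(_ Us)/negP[]: (2 < size (a :: s))%N.
  by rewrite /= rcons_path Gs' -def_x.
(* The cycle has at least three vertices: an empty [s] gives [x = a], and a single step would be the
   excluded edge itself. *)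
case: s Gs def_x {Us Gs'} => [|b [|c s]] //= Gs def_x.
  by rewrite def_x eqxx in neq_xa.
by rewrite -def_x setUC eqxx andbF in Gs.
Qed.

(** Where two simple paths diverge, into [a] and [b], their tails never return to [x]. If they met
    again, [a] would reach [x] through [b] without using [xa], although [xa] is a bridge. *)
Lemma acyclic_path_inj G x s t : acyclic G ->
  path (adj G) x s -> uniq (x :: s) -> path (adj G) x t -> uniq (x :: t) ->
  last x s = last x t -> s = t.
Proof.
move=> acG; elim: s x t => [|a s IHs] x [|b t] //.
- move=> _ _ _ /= /andP[xbt _] def_x.
  by rewrite def_x mem_last in xbt.
- move=> _ /= /andP[xas _] _ _ def_x.
  by rewrite -def_x mem_last in xas.
move=> /= /andP[xa Gs] /andP[xas Us] /andP[xb Gt] /andP[xbt Ut] eq_last.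
have [eq_ab | neq_ab] := eqVneq a b.
  by subst b; congr (_ :: _); apply: (IHs a).
have neq_xa: x != a by move: xas; rewrite inE negb_or => /andP[].
case/negP: (acyclic_bridge acG xa neq_xa); set e := [rel b c | _].
have e_sym: connect_sym e.
  by apply: sym_connect_sym => c d; rewrite /= adj_sym setUC.
(* A path that misses [x] cannot use the edge [xa]. *)
have avoid c r : path (adj G) c r -> x \notin c :: r -> connect e c (last c r).
  move=> Gr xr; apply/connectP; exists r => //.
  apply: (@sub_in_path _ (predC1 x)) Gr => [d d' | ].
    rewrite !inE eq_sym => nd; rewrite eq_sym => nd' /= -> /=.
    by apply: contraNneq nd => eq_e; move/setP/(_ x): eq_e;
       rewrite !inE eqxx (negPf nd') orbF => ->.
  by apply/allP => d dr; rewrite inE; apply: contraNneq xr => <-.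
apply: connect_trans (avoid _ _ Gs xas) _; rewrite eq_last e_sym.
apply: connect_trans (_ : connect e x b) (avoid _ _ Gt xbt).
apply: connect1; rewrite /= xb /=; apply: contraNneq neq_ab => eq_e.
apply/eqP/esym/(@set2_injr x) => //.
by move: xbt; rewrite inE negb_or => /andP[].
Qed.

Lemma path_edges_sub x s e : e \in path_edges x s ->
  e \subset [set y in x :: s].
Proof.
elim: s x => //= a s IHs x; rewrite inE => /predU1P[-> | /IHs/subsetP se].
  by apply/subsetP=> y; rewrite !inE => /orP[]->; rewrite ?orbT.
by apply/subsetP=> y /se; rewrite !inE => ->; rewrite orbT.
Qed.

Lemma uniq_path_edges x s : uniq (x :: s) -> uniq (path_edges x s).
Proof.
elim: s x => //= a s IHs x /andP[xas Us]; rewrite IHs // andbT.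
apply: contra xas => /path_edges_sub/subsetP/(_ x).
by rewrite set21 inE => ->.
Qed.

Lemma mem_path_edges G x s e : path (adj G) x s ->
  e \in path_edges x s -> e \in edges G.
Proof.
by elim: s x => //= a s IHs x /andP[xa /IHs Gs]; rewrite inE => /predU1P[->|].
Qed.

Lemma mem_path_verts G x s : wf_graph G -> x \in verts G ->
  path (adj G) x s -> {subset x :: s <= verts G}.
Proof.
move=> wfG; elim: s x => [|a s IHs] x xG /=; first by move=> _ y /[!inE] /eqP->.
case/andP=> xa Gs y; rewrite inE => /predU1P[-> // |].
by apply: IHs => //; have [] := adj_verts wfG xa.
Qed.

Lemma path_prefix G x s y : path (adj G) x s -> uniq (x :: s) -> y \in x :: s ->
  exists2 t, prefix t s &
    [/\ path (adj G) x t, uniq (x :: t) & last x t = y].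
Proof.
move=> + + /splitPl ys; case: ys => s1 s2 eq_last.
rewrite cat_path -cat_cons cat_uniq => /andP[Gs1 _] /andP[Us1 _].
by exists s1; rewrite // prefix_prefix.
Qed.

(** A simple path has no chord: for an edge at the first vertex, the one-edge path and the
    corresponding prefix of the path coincide by uniqueness; other edges are handled by induction on
    the tail. *)
Lemma acyclic_chord G x s a b : wf_graph G -> acyclic G ->
  path (adj G) x s -> uniq (x :: s) -> a \in x :: s -> b \in x :: s ->
  adj G a b -> [set a; b] \in path_edges x s.
Proof.
move=> wfG acG; elim: s x a b => [|c s IHs] x a b.
  move=> _ _ /[!inE] /eqP-> /eqP-> /(adj_verts wfG)[_ _].
  by rewrite eqxx.
move=> Gs Us.
have from_x d : d \in x :: c :: s -> adj G x d ->
    [set x; d] \in path_edges x (c :: s).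
  move=> ds xd; have [_ _ neq_xd] := adj_verts wfG xd.
  have [t /prefixP[t' def_s] [Gt Ut last_t]] := path_prefix Gs Us ds.
  suff def_t: t = [:: d].
    by move: def_s; rewrite def_t => -[-> _] /=; apply: mem_head.
  by apply: (acyclic_path_inj (x := x) acG); rewrite //= ?xd ?inE ?andbT.
rewrite [a \in _]inE; case/predU1P=> [-> | a_s]; first exact: from_x.
rewrite [b \in _]inE; case/predU1P=> [-> | b_s].
  by rewrite adj_sym setUC; apply: from_x; rewrite inE a_s orbT.
move=> ab; rewrite inE IHs ?orbT //; first by case/andP: Gs.
by case/andP: Us.
Qed.

(** * Trees whose only possible pendant vertices are two given ones *)

(** The end of [t] lies off [s], so it is not pendant and has a neighbour [w] other than its
    predecessor. By uniqueness of paths, [w] can lie neither on [t] nor on [s]. *)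
Lemma extend_off_path G x y s t : is_tree G ->
    (forall u, pendant G u -> u = x \/ u = y) -> path_from_to G x y s ->
    path (adj G) x t -> uniq (x :: t) -> last x t \notin x :: s ->
  exists w, [/\ path (adj G) x (rcons t w), uniq (x :: rcons t w) &
                w \notin x :: s].
Proof.
move=> [wfG _ _ acG] pG /and4P[xG Gs Us /eqP last_s].
case/lastP: t => [|t u] Gt Ut; first by rewrite mem_head.
rewrite last_rcons => us.
have /andP[Gt' tu]: path (adj G) x t && adj G (last x t) u by rewrite -rcons_path.
have Ut': uniq (x :: t) by move: Ut; rewrite -rcons_cons rcons_uniq => /andP[].
have [||w neq_w uw] := @nonpendant_adj G u (last x t) wfG.
- apply: contra us => /pG[->|->]; first exact: mem_head.
  by rewrite -last_s mem_last.
- by rewrite adj_sym.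
have [_ _ neq_uw] := adj_verts wfG uw.
have Gtw: path (adj G) x (rcons (rcons t u) w) by rewrite rcons_path Gt last_rcons.
have wt: w \notin x :: rcons t u.
  apply: contra neq_w; rewrite -rcons_cons mem_rcons inE eq_sym (negPf neq_uw) /=.
  move=> /(path_prefix Gt' Ut')[t1 /prefixP[t2 def_t] [Gt1 Ut1 last_t1]].
  (* Were [w] on [x :: t], the prefix [t1] ending at [w], followed by [u], would be a second simple
     path from [x] to [u]. *)
  suff ->: t = t1 by rewrite last_t1.
  apply/(@rcons_injl _ u)/(acyclic_path_inj (x := x) acG) => //.
  - by rewrite rcons_path Gt1 last_t1 adj_sym.
  - rewrite -rcons_cons rcons_uniq Ut1 andbT.
    move: Ut; rewrite -rcons_cons rcons_uniq => /andP[+ _]; apply: contra.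
    by rewrite def_t -cat_cons mem_cat => ->.
  - by rewrite !last_rcons.
have Utw: uniq (x :: rcons (rcons t u) w) by rewrite -rcons_cons rcons_uniq wt.
exists w; split=> //; apply: contra us.
(* Were [w] on [x :: s], the prefix of [s] ending at [w] would be [t] (whose last vertex is [u])
   followed by [w], which puts [u] on [s]. *)
move=> /(path_prefix Gs Us)[s1 /prefixP[s2 ->] [Gs1 Us1 last_s1]].
have ->: s1 = rcons (rcons t u) w.
  by apply: (acyclic_path_inj (x := x) acG); rewrite ?last_rcons.
by rewrite -cat_cons mem_cat -!rcons_cons mem_rcons inE mem_rcons mem_head orbT.
Qed.

(* Otherwise a path from x ending off s could be prolonged forever. *)
Lemma path_spans_tree G x y s : is_tree G ->
    (forall u, pendant G u -> u = x \/ u = y) -> path_from_to G x y s ->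
  verts G = [set z in x :: s] /\ edges G = [set e in path_edges x s].
Proof.
move=> treeG pG Ps; have [wfG _ cG acG] := treeG.
have /and4P[xG Gs Us /eqP last_s] := Ps.
have all_s z : z \in verts G -> z \in x :: s.
  move=> zG; apply/negPn/negP=> zs.
  have [t0 /and4P[_ Gt0 Ut0 /eqP last_t0]] := connected_path cG xG zG.
  have long n : exists t, [/\ path (adj G) x t, uniq (x :: t),
      last x t \notin x :: s & (n <= size t)%N].
    elim: n => [|n [t [Gt Ut ts le_n]]]; first by exists t0; rewrite last_t0.
    have [w [Gtw Utw ws]] := extend_off_path treeG pG Ps Gt Ut ts.
    by exists (rcons t w); rewrite last_rcons size_rcons.
  (* Then [x :: t] has more than [#|V|] distinct vertices. *)
  have [t [_ Ut _ le_t]] := long #|V|.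
  have := max_card (mem (x :: t)).
  by rewrite (card_uniqP Ut) leqNgt ltnS le_t.
split; apply/setP=> e; rewrite inE; apply/idP/idP; first exact: all_s.
- exact: mem_path_verts.
- move=> eG; have /forall_inP/(_ e eG)/andP[/cards2P[a [b [_ def_e]]] eV] := wfG.
  move: eG eV; rewrite def_e subUset !sub1set => ab /andP[/all_s a_s /all_s b_s].
  exact: (acyclic_chord wfG acG).
- exact: mem_path_edges.
Qed.

Lemma pendant_endpoint G x y : is_tree G ->
    (forall u, pendant G u -> u = x \/ u = y) ->
    x != y -> x \in verts G -> y \in verts G -> pendant G x.
Proof.
move=> treeG pG neq_xy xG yG; have [wfG _ cG _] := treeG.
have [[|c s] Ps] := connected_path cG xG yG.
  by have /and4P[_ _ _ /eqP/= eq_xy] := Ps; rewrite eq_xy eqxx in neq_xy.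
have [_ def_E] := path_spans_tree treeG pG Ps.
have /and4P[_ /andP[xc _] /andP[xs _] _] := Ps.
apply/negPn/negP => /(nonpendant_adj wfG) /(_ xc)[w neq_w xw].
have [_ _ neq_xw] := adj_verts wfG xw.
move: xw; rewrite /adj def_E inE /= inE => /orP[/eqP/(set2_injr neq_xw)/eqP|].
  by rewrite (negPf neq_w).
(* All later edges of the path lie inside [c :: s], which misses [x]. *)
move=> /path_edges_sub/subsetP/(_ x); rewrite set21 inE => /(_ isT).
by apply/negP.
Qed.

(** An interior vertex of a simple path has two distinct neighbours on it, whereas [u] has only
    [v]. *)
Lemma path_avoids_pendant G x s u v : (forall w, adj G u w -> w = v) ->
  path (adj G) x s -> uniq (x :: s) -> u != x -> u != last x s -> u \notin x :: s.
Proof.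
move=> uG Gs Us neq_ux neq_ul; rewrite inE negb_or neq_ux /=.
apply/negP=> us; move: Gs Us neq_ul; case/splitPr: us => s1 [|c s2].
  by move=> _ _; rewrite last_cat /= eqxx.
rewrite cat_path -cat_cons cat_uniq => /andP[_ Gs] /and3P[_ /hasPn disj _] _.
have /and3P[lu uc _] := Gs; have /negP[] : c \notin x :: s1.
  by apply: disj; rewrite !inE eqxx orbT.
by rewrite (uG _ uc) -(uG _ (etrans (adj_sym _ _ _) lu)) mem_last.
Qed.

(** * Deleting and adding a pendant vertex *)

Definition del_pendant G u v : graph V := (verts G :\ u, edges G :\ [set u; v]).

Definition add_pendant G u v : graph V := (u |: verts G, [set u; v] |: edges G).

Lemma adj_add_pendant G u v x y :
  adj (add_pendant G u v) x y = ([set x; y] == [set u; v]) || adj G x y.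
Proof. by rewrite /adj /= !inE. Qed.

Section Del.
Variables (G : graph V) (u v : V).
Hypothesis uG : forall w, adj G u w -> w = v.

Let G' := del_pendant G u v.

Lemma path_del_pendant x s : path (adj G) x s -> u \notin x :: s ->
  path (adj G') x s.
Proof.
move=> Gs us; apply: (@sub_in_path _ (predC1 u)) Gs => [a b|].
  rewrite !inE => au bu ab; rewrite /adj /= !inE [_ \in _]ab andbT.
  apply: contraNneq au => /setP/(_ u); rewrite !inE eqxx /= eq_sym.
  by rewrite [u == b]eq_sym (negPf bu) orbF => ->.
by apply/allP=> a a_s; rewrite inE; apply: contraNneq us => <-.
Qed.

Lemma path_from_to_del_pendant x y s : u != x -> u != y ->
  path_from_to G x y s -> path_from_to G' x y s.
Proof.
move=> neq_ux neq_uy /and4P[xG Gs Us /eqP last_s].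
rewrite /path_from_to Us last_s eqxx !andbT !inE eq_sym neq_ux xG /=.
apply: path_del_pendant => //; apply: path_avoids_pendant uG Gs Us neq_ux _.
by rewrite last_s.
Qed.

Lemma del_pendant_wf : wf_graph G -> wf_graph G'.
Proof.
move=> wfG; apply/forall_inP=> e /[!inE] /andP[neq_e eG].
have /forall_inP/(_ e eG)/andP[-> eV] := wfG; rewrite subsetD1 eV /=.
apply: contra neq_e => /(edgeP wfG eG)[w _ def_e].
by rewrite def_e; apply/eqP; congr [set u; _]; apply: uG; rewrite /adj -def_e.
Qed.

Lemma del_pendant_connected : connected G -> connected G'.
Proof.
move=> cG; apply/forall_inP=> x; rewrite !inE => /andP[neq_xu xG].
apply/forall_inP=> y; rewrite !inE => /andP[neq_yu yG].
have [s Ps] := connected_path cG xG yG.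
have /and4P[_ G's _ /eqP<-] : path_from_to G' x y s.
  by apply: path_from_to_del_pendant; rewrite // eq_sym.
by apply/connectP; exists s.
Qed.

Lemma del_pendant_tree x : is_tree G -> x \in verts G -> x != u -> is_tree G'.
Proof.
move=> [wfG _ cG acG] xG neq_xu; split.
- exact: del_pendant_wf.
- by apply/set0Pn; exists x; rewrite !inE neq_xu.
- exact: del_pendant_connected.
- move=> c size_c Uc; apply: contra (acG c size_c Uc).
  by apply: sub_cycle => a b; rewrite /adj !inE => /andP[].
Qed.

End Del.

(** * Correspondence between subtrees before and after the deletion *)

Section Subtrees.
Variables (G : graph V) (u v : V).
Hypotheses (wfG : wf_graph G) (uv : adj G u v).
Hypothesis uG : forall w, adj G u w -> w = v.

Let G' := del_pendant G u v.

Lemma subtree_del_pendant H : u \notin verts H -> subtree H G' = subtree H G.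
Proof.
move=> uH; rewrite /subtree; congr (_ && _); rewrite /subgraph.
have [wfH /= | //] := boolP (wf_graph H); rewrite !subsetD1 uH andbT.
congr (_ && _); rewrite -[RHS]andbT; congr (_ && _).
(* By well-formedness, a subgraph without [u] cannot contain the edge [uv]. *)
by apply: contra uH => /(adj_verts wfH)[].
Qed.

(** A path inside [H] from [u] to another vertex has to leave [u] through its sole neighbour [v]. *)
Lemma subtree_pendant_adj H x : subtree H G -> u \in verts H ->
  x \in verts H -> x != u -> adj H u v.
Proof.
case/and3P=> sHG _ cH uH xH neq_xu.
have [[|w s] /and4P[_ Hs _ /eqP last_s]] := connected_path cH uH xH.
  by rewrite -last_s eqxx in neq_xu.
have /andP[uw _] := Hs.
by rewrite -(uG (subgraph_adj sHG uw)).
Qed.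

Lemma del_pendant_subtree H : subtree H G -> adj H u v ->
  subtree (del_pendant H u v) G'.
Proof.
case/and3P=> sHG _ cH Huv; have wfH := subgraph_wf sHG.
have uH w : adj H u w -> w = v by move/(subgraph_adj sHG)/uG.
have [_ vH neq_uv] := adj_verts wfH Huv.
apply/and3P; split; last exact: del_pendant_connected.
- apply/and3P; split; first exact: del_pendant_wf.
    by case/and3P: sHG => _ sV _; apply: setSD.
  by case/and3P: sHG => _ _ sE; apply: setSD.
- by apply/set0Pn; exists v; rewrite !inE eq_sym neq_uv.
Qed.

Lemma add_pendant_subtree H : subtree H G' -> v \in verts H ->
  subtree (add_pendant H u v) G.
Proof.
have [uV vV neq_uv] := adj_verts wfG uv.
case/and3P=> /and3P[wfH sV sE] _ cH vH; apply/and3P; split.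
- apply/and3P; split.
  + apply/forall_inP=> e /[!inE] /predU1P[-> | eH].
      by rewrite cards2 neq_uv subUset !sub1set !inE eqxx vH orbT.
    have /forall_inP/(_ e eH)/andP[-> eV] := wfH.
    exact: subset_trans eV (subsetUr _ _).
  + by rewrite subUset sub1set uV (subset_trans sV) ?subsetDl.
  + by rewrite subUset sub1set [_ \in _]uv (subset_trans sE) ?subsetDl.
- by apply/set0Pn; exists u; rewrite !inE eqxx.
(* Connectedness is checked through the hub [v]: every vertex, including [u], reaches it. *)
have to_v x : x \in verts (add_pendant H u v) ->
    connect (adj (add_pendant H u v)) x v.
  rewrite !inE => /predU1P[-> | xH].
    by apply: connect1; rewrite adj_add_pendant eqxx.
  have /forall_inP/(_ x xH)/forall_inP/(_ v vH) := cH.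
  apply: connect_sub => a b ab; apply: connect1.
  by rewrite adj_add_pendant ab orbT.
apply/forall_inP=> x xH; apply/forall_inP=> y yH.
apply: connect_trans (to_v x xH) _.
by rewrite (sym_connect_sym (@adj_sym _)) to_v.
Qed.

Lemma add_pendantK H : subtree H G' -> del_pendant (add_pendant H u v) u v = H.
Proof.
case/and3P=> /and3P[_ sV sE] _ _.
rewrite /del_pendant /= !setU1K -?surjective_pairing //.
  apply: contraTN sE => eH; apply/subsetPn; exists [set u; v] => //.
  by rewrite !inE eqxx.
by apply: contraTN sV => uH; apply/subsetPn; exists u; rewrite ?inE ?eqxx.
Qed.

Lemma del_pendantK H : u \in verts H -> adj H u v ->
  add_pendant (del_pendant H u v) u v = H.
Proof.
by move=> uH Huv; rewrite /add_pendant /= !setD1K // -surjective_pairing.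
Qed.

End Subtrees.
End GraphTheory.

(** * Effect of a contraction on the generating function, and its value on a path *)

Section Contraction.
Variables (V : finType) (R : comPzRingType).
Implicit Types (G H : graph V) (p : V -> R) (g : {set V} -> R) (u v : V).

(** Convertible to the update of [p] in [step_contract], just as [del_pendant] is to the update of
    the tree. *)
Definition contract_weight p g u v : V -> R :=
  [eta p with v |-> p v * (p u * g [set u; v] + 1)].

(** The weight is linear in the value at [v]. The extra summand is the weight of [H] with [u] and
    the edge [uv] attached, as [weight_add_pendant] shows. *)
Lemma weight_contract p g u v H :
  weight (contract_weight p g u v) g H =
  weight p g H +
    (if v \in verts H then p u * g [set u; v] * weight p g H else 0).
Proof.
have eq_off x : x != v -> contract_weight p g u v x = p x.
  by rewrite /contract_weight /= => /negPf->.
have eq_on : contract_weight p g u v v = p v * (p u * g [set u; v] + 1).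
  by rewrite /contract_weight /= eqxx.
rewrite /weight; case: ifPn => vH.
  rewrite (bigD1 v) //= !(bigD1 (P := mem (verts H)) v) //= eq_on.
  rewrite (eq_bigr p) => [|x /andP[_ /eq_off //]].
  set P := \prod_(x in _ | _) p x; set E := \prod_(e in _) g e.
  set a := p u * _.
  by rewrite mulrDr mulr1 !mulrDl addrC [p v * a]mulrC !mulrA.
rewrite addr0; congr (_ * _); apply: eq_bigr => x xH; apply: eq_off.
by apply: contraNneq vH => <-.
Qed.

Lemma weight_add_pendant p g u v H :
  u \notin verts H -> [set u; v] \notin edges H ->
  weight p g (add_pendant H u v) = p u * g [set u; v] * weight p g H.
Proof. by move=> uH eH; rewrite /weight /= !big_setU1 //= mulrACA. Qed.

(** The subtrees of [G] are split by membership of [u]: those without [u] give the first summand of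
    [weight_contract], and those with [u] are matched by [add_pendant] with the subtrees of [G']
    through [v], giving the second. *)
Lemma subtree_gf_contract G p g u v vi vj :
    wf_graph G -> adj G u v -> (forall w, adj G u w -> w = v) ->
    u != vi -> u != vj ->
  subtree_gf (del_pendant G u v) (contract_weight p g u v) g vi vj =
  subtree_gf G p g vi vj.
Proof.
move=> wfG uv uG neq_ui neq_uj; set G' := del_pendant G u v.
have [_ _ neq_uv] := adj_verts wfG uv.
have notin_u H : subtree H G' -> u \notin verts H.
  by case/and3P=> /and3P[_ + _] _ _; rewrite subsetD1 => /andP[].
rewrite /subtree_gf (eq_bigr _ (fun H _ => weight_contract p g u v H)).
rewrite big_split /= [RHS](bigID (fun H => u \in verts H)) /= [RHS]addrC.
congr (_ + _).
  apply: eq_bigl => H; have [uH | uH] := boolP (u \in verts H).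
    by rewrite andbF; apply: contraTF uH => /andP[/notin_u].
  by rewrite andbT (subtree_del_pendant _ _ uH).
rewrite -big_mkcondr /= [RHS](reindex_onto (fun H => add_pendant H u v)
  (fun H => del_pendant H u v)) /= => [|H]; last first.
  (* A subtree containing [u] also contains [vi], which differs from [u], hence the edge [uv]; so
     deleting and re-adding [u] restores it. *)
  case/andP=> /and3P[sHG iH _] uH; apply: del_pendantK => //.
  by apply: (subtree_pendant_adj (x := vi) uG sHG uH iH); rewrite eq_sym.
apply: congr_big => // H => [|/andP[/and3P[sHG' _ _] vH]].
  rewrite !inE eqxx !(eq_sym _ u) (negPf neq_ui) (negPf neq_uj) /= andbT.
  apply/idP/idP=> [/andP[/and3P[sH -> ->] vH] |
                  /andP[/and3P[sH iH jH] /eqP def_H]].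
    by rewrite (add_pendant_subtree wfG uv) // (add_pendantK sH) eqxx.
  (* Conversely, deleting [u] from the extended tree leaves a subtree of [G'], identified with [H]
     by the round-trip equation [def_H]. *)
  have Huv: adj (add_pendant H u v) u v by rewrite adj_add_pendant eqxx.
  have := del_pendant_subtree uG sH Huv; rewrite def_H => ->.
  have /and3P[/subgraph_wf wfH _ _] := sH; have [_ + _] := adj_verts wfH Huv.
  by rewrite iH jH !inE eq_sym (negPf neq_uv).
rewrite weight_add_pendant ?notin_u //.
have [/and3P[wfH _ _] _ _] := and3P sHG'.
by apply: contra (notin_u H sHG') => /(adj_verts wfH)[].
Qed.

Lemma subtree_gf_path G p g x y s : acyclic G -> wf_graph G ->
    connected G -> path_from_to G x y s ->
    verts G = [set z in x :: s] -> edges G = [set e in path_edges x s] ->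
  subtree_gf G p g x y =
    (\prod_(z <- x :: s) p z) * \prod_(e <- path_edges x s) g e.
Proof.
move=> acG wfG cG /and4P[xG Gs Us /eqP last_s] def_V def_E.
rewrite /subtree_gf (big_pred1 G) => [|H].
  rewrite /weight def_V def_E !big_uniq //; last exact: uniq_path_edges.
  by congr (_ * _); apply: eq_bigl => z; rewrite inE.
apply/and3P/eqP=> [[/and3P[sHG _ cH] xH yH] | ->]; last first.
  split=> //; last by rewrite def_V inE -last_s mem_last.
  by rewrite /subtree /subgraph wfG !subxx cG !andbT; apply/set0Pn; exists x.
(* A subtree containing both ends contains a path between them, which is [s] by uniqueness, hence
   all of [G]. *)
have [t /and4P[_ Ht Ut /eqP last_t]] := connected_path cH xH yH.
have def_t: s = t.
  apply: (acyclic_path_inj acG Gs Us _ Ut); last by rewrite last_s.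
  exact: sub_path (subgraph_adj sHG) _ _ Ht.
have /and3P[wfH sV sE] := sHG.
rewrite [H]surjective_pairing [G]surjective_pairing; congr (_, _); apply/eqP.
  rewrite eqEsubset [_ \subset _]sV -/(verts G) def_V; apply/subsetP=> z.
  by rewrite inE def_t; apply: mem_path_verts.
rewrite eqEsubset [_ \subset _]sE -/(edges G) def_E; apply/subsetP=> e.
by rewrite inE def_t; apply: mem_path_edges.
Qed.

End Contraction.

(** * Termination, invariant and progress of the procedure *)

Section Correctness.
Variables (V : finType) (R : comPzRingType) (T : graph V).
Variables (f : V -> R) (g : {set V} -> R) (vi vj : V).

(** Each vertex counts twice because one round of the loop takes two transitions: Step 3 to Step 4
    goes from [2n + 1] to [2(n - 1) + 2 = 2n], and Step 4 back to Step 3 loses one more. *)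
Definition state_measure (st : state V R) : nat :=
  match st with
  | Step1 => #|verts T|.*2 + 4
  | Step2 G _ => #|verts G|.*2 + 3
  | Step3 G _ => #|verts G|.*2 + 1
  | Step4 G _ => #|verts G|.*2 + 2
  | Step5 _ _ => 1
  | Answer _ => 0
  end.

Lemma step_measure st st' : step T f g vi vj st st' ->
  (state_measure st' < state_measure st)%N.
Proof.
case=> //=; try by move=> *; rewrite ?ltn_add2l ?addnS.
move=> G p u v /andP[/andP[uG _] _] _; rewrite [in ltnRHS](cardsD1 u) uG.
by rewrite add1n doubleS addn1 addn2.
Qed.

Lemma procedure_terminates : terminates T f g vi vj.
Proof.
suff acc n st : (state_measure st < n)%N ->
    Acc (fun st' st => step T f g vi vj st st') st by exact: (acc _ _ (ltnSn _)).
elim: n st => [|n IHn] st; first by rewrite ltn0.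
rewrite ltnS => le_st; constructor=> st' /step_measure lt_st'.
by apply: IHn; apply: leq_trans lt_st' _.
Qed.

Hypotheses (treeT : is_tree T) (vi_in : vi \in verts T) (vj_in : vj \in verts T).
Hypothesis vi_neq_vj : vi != vj.

(** The clause on paths is kept because Step 5 reads its path off the original [T], while [p]
    belongs to the contracted tree. *)
Definition faithful (G : graph V) (p : V -> R) : Prop :=
  [/\ is_tree G, vi \in verts G,
      forall s, path_from_to T vi vj s -> path_from_to G vi vj s &
      subtree_gf G p g vi vj = subtree_gf T f g vi vj].

Lemma faithful_contract G p u v : faithful G p ->
    contractible vi vj G u -> [set u; v] \in edges G ->
  faithful (del_pendant G u v) (contract_weight p g u v).
Proof.
move=> [treeG iG pathG gfG] /and3P[penu neq_ui neq_uj] uv.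
have [wfG _ _ _] := treeG.
have uG w : adj G u w -> w = v by apply: pendant_adj wfG penu uv.
have neq_iu : vi != u by rewrite eq_sym.
split.
- exact: (del_pendant_tree uG treeG iG).
- by rewrite !inE neq_iu.
- by move=> s /pathG; apply: path_from_to_del_pendant.
- by rewrite (subtree_gf_contract _ _ wfG).
Qed.

Lemma uncontractible_pendant G : ~ (exists u, contractible vi vj G u) ->
  forall u, pendant G u -> u = vi \/ u = vj.
Proof.
move=> nocon u penu.
have [-> | neq_ui] := eqVneq u vi; first by left.
have [-> | neq_uj] := eqVneq u vj; first by right.
by case: nocon; exists u; rewrite /contractible penu neq_ui.
Qed.

Lemma path_in_T : exists s, path_from_to T vi vj s.
Proof. by case: treeT => _ _ cT _; apply: connected_path. Qed.

(** The test of Step 2 agrees with that of Step 4, so Step 3 is entered only when a vertex can be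
    contracted. *)
Lemma end_pathP :
  end_path vi vj T <-> ~ (exists u, contractible vi vj T u).
Proof.
split=> [[_ endT] [u /and3P[penu neq_ui neq_uj]] | nocon].
  have: u \in [set vi; vj] by rewrite -endT inE.
  by rewrite !inE (negPf neq_ui) (negPf neq_uj).
have pendantT := uncontractible_pendant nocon.
have [s Ps] := path_in_T; have /and4P[_ _ Us _] := Ps.
have [def_V def_E] := path_spans_tree treeT pendantT Ps.
split; first by exists vi, s.
apply/setP=> u; rewrite !inE; apply/idP/orP=> [penu | []/eqP->].
- by case: (pendantT u penu) => ->; rewrite eqxx; [left | right].
- exact: pendant_endpoint treeT pendantT vi_neq_vj vi_in vj_in.
- apply: (pendant_endpoint (y := vi) treeT); rewrite // 1?eq_sym // => w.
  by case/pendantT; [right | left].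
Qed.

(** The clause on contractible vertices at Step 3 ensures progress; the one at Step 5 makes the
    current tree the path from [vi] to [vj]. *)
Definition invariant (st : state V R) : Prop :=
  match st with
  | Step1 => True
  | Step2 G p => G = T /\ p = f
  | Step3 G p => faithful G p /\ exists u, contractible vi vj G u
  | Step4 G p => faithful G p
  | Step5 G p => faithful G p /\ ~ exists u, contractible vi vj G u
  | Answer a => a = subtree_gf T f g vi vj
  end.

(** Finiteness of [V] lets the branches of Steps 2 and 4 be decided without excluded middle. *)
Lemma decide_contractible G : decidable (exists u, contractible vi vj G u).
Proof. exact: decP (existsP (P := contractible vi vj G)). Qed.

Lemma invariant_step st st' :
  step T f g vi vj st st' -> invariant st -> invariant st'.
Proof.
case=> //=.
- move=> G p endG [def_G ->]; rewrite def_G in endG *; split=> //.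
  exact/end_pathP.
- move=> G p nendG [def_G ->]; rewrite def_G in nendG *; split=> //.
  by case: (decide_contractible T) => // /end_pathP.
- by move=> G p u v conu uv [faithG _]; apply: faithful_contract.
- move=> G p s Ps [[treeG _ pathG <-] nocon]; have [wfG _ cG acG] := treeG.
  have [def_V def_E] := path_spans_tree treeG (uncontractible_pendant nocon) (pathG s Ps).
  by rewrite (subtree_gf_path _ _ acG wfG cG (pathG s Ps)).
Qed.

Lemma reachable_invariant st : reachable T f g vi vj st -> invariant st.
Proof.
have: invariant Step1 by [].
rewrite /reachable => + Rst; elim: Rst => [st1 st2 /invariant_step // | // |].
by move=> st1 st2 st3 _ IH12 _ IH23 /IH12.
Qed.

Lemma procedure_never_stuck : never_stuck T f g vi vj.
Proof.
case=> [|G p|G p|G p|G p|a] /reachable_invariant /= inv; last by left; exists a.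
all: right.
- by exists (Step2 T f); constructor.
- have [-> _] := inv; case: (decide_contractible T) => [conT | noconT].
    by exists (Step3 T p); constructor=> /end_pathP.
  by exists (Step5 T p); constructor; apply/end_pathP.
- have [[[wfG _ _ _] _ _ _] [u conu]] := inv; have /and3P[/andP[_ degu] _ _] := conu.
  (* Degree one supplies the pendant edge, whose other end is the [v] of the contraction. *)
  have /card_gt0P[e] : (0 < degree G u)%N by rewrite (eqP degu).
  rewrite inE => /andP[eG /(edgeP wfG eG)[v _ def_e]]; rewrite def_e in eG.
  by eexists; apply: (step_contract _ _ _ _ conu eG).
- case: (decide_contractible G) => [conG | noconG].
    by exists (Step3 G p); constructor.
  by exists (Step5 G p); constructor.
- by have [s Ps] := path_in_T; eexists; apply: step_answer Ps.
Qed.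

End Correctness.

Theorem mainTheorem3 (R : comPzRingType) (V : finType) (T : graph V)
    (f : V -> R) (g : {set V} -> R) (vi vj : V)
    (treeT : is_tree T) (two_verts : (2 <= #|verts T|)%N)
    (vi_in : vi \in verts T) (vj_in : vj \in verts T) (vi_neq_vj : vi != vj) :
  [/\ terminates T f g vi vj,
      never_stuck T f g vi vj &
      forall a : R, reachable T f g vi vj (Answer a) ->
        a = subtree_gf T f g vi vj].
Proof.
split; [exact: procedure_terminates | exact: procedure_never_stuck |].
by move=> a /(reachable_invariant treeT vi_in vj_in vi_neq_vj).
Qed.
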